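(* Let $X$ be an $\omega$-homogeneous metric space. The following conditions are equivalent. (i) The full group of isometries $\mathrm{Iso}(X)$ with the pointwise topology is extremely amenable. (ii) Let $F\subseteq X$ be a finite metric subspace, and let the set $X^{\hookleftarrow F}$ of all isometric embeddings of $F$ into $X$ be coloured using finitely many colours. Then for every finite metric subspace $G\subseteq X$ and every $\varepsilon>0$ there is an isometric copy $G'\subseteq X$ of $G$ such that the set of all isometric embeddings $F\hookrightarrow X$ that factor through $G'$ (that is, have image contained in $G'$) is monochromatic up to $\varepsilon$.
   Context: A metric space $X$ is $\omega$-homogeneous if every isometry between two finite subspaces of $X$ extends to an isometry of $X$ onto itself. $\mathrm{Iso}(X)$ is the group of all isometries of $X$ onto itself. A topological group is extremely amenable if every continuous action of it on a (nonempty) compact space has a fixed point. For a finite metric subspace $F$ of $X$, the set $X^{\hookleftarrow F}$ carries the supremum metric $d_{\sup}(i,j)=\max\{d(i(x),j(x)) : x\in F\}$. A colouring of a metric space $Y$ using finitely many colours is a finite partition $\gamma$ of $Y$; a subset $Z\subseteq Y$ is monochromatic up to $\varepsilon>0$ if $Z$ is contained in the $\varepsilon$-neighbourhood of some $A\in\gamma$. Here $Y=X^{\hookleftarrow F}$ with the metric $d_{\sup}$. *)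

(* Defs.v *)
From HB Require Import structures.
From mathcomp Require Import all_boot all_order all_algebra finmap.
From mathcomp Require Import all_classical all_reals all_analysis.

Set Implicit Arguments.
Unset Strict Implicit.
Unset Printing Implicit Defensive.

Import Order.TTheory GRing.Theory Num.Theory.

Local Open Scope classical_set_scope.
Local Open Scope ring_scope.

HB.mixin Record isTopologicalGroup G & Group G & Topological G := {
  mulg_continuous : continuous (fun p : G * G => (p.1 * p.2)%g) ;
  invg_continuous : continuous (fun g : G => (g^-1)%g)
}.

#[short(type="topologicalGroupType")]
HB.structure Definition TopologicalGroup :=
  { G of Group G & Topological G & isTopologicalGroup G }.

Definition continuous_action (G : topologicalGroupType) (K : topologicalType)
    (a : G -> K -> K) : Prop :=
  [/\ forall x, a 1%g x = x,
      forall g h x, a (g * h)%g x = a g (a h x)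
    & continuous (fun p : G * K => a p.1 p.2)].

(* Compact spaces are Hausdorff: otherwise the left translation action of a
   nontrivial group on itself with the indiscrete topology would show that it is
   not extremely amenable. *)
Definition extremely_amenable (G : topologicalGroupType) : Prop :=
  forall (K : topologicalType) (a : G -> K -> K),
    [set: K] !=set0 -> compact [set: K] -> hausdorff_space K ->
    continuous_action a ->
    exists x, forall g, a g x = x.

Definition isometric_embedding (R : realType) (A B : metricType R) (f : A -> B) : Prop :=
  forall x y, mdist (f x) (f y) = mdist x y.

Definition is_isometry (R : realType) (A B : metricType R) (f : A -> B) : Prop :=
  isometric_embedding f /\ forall y, exists x, f x = y.

Section FiniteSubspace.
Context {R : realType} {X : metricType R} (F : {fset X}).

Let dist (x y : F) : R := mdist (val x) (val y).

Let distxx x : dist x x = 0. Proof. exact: mdistxx. Qed.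

Let dist_eq0 x y : dist x y = 0 -> x = y.
Proof. by move=> /mdist_positivity /val_inj. Qed.

Let dist_sym x y : dist x y = dist y x. Proof. exact: metric_sym. Qed.

Let dist_triangle y x z : dist x z <= dist x y + dist y z.
Proof. exact: metric_triangle. Qed.

HB.instance Definition _ := @isMetric.Build R (fset_sub_type F) dist
  distxx dist_eq0 dist_sym dist_triangle.

End FiniteSubspace.

Section IsometryGroup.
Context (R : realType) (X : metricType R).

Record Iso := MkIso { iso_fun :> X -> X ; isoP : is_isometry iso_fun }.

Lemma iso_inj (f : Iso) : injective f.
Proof.
move=> x y fxy; apply: mdist_positivity.
by rewrite -(isoP f).1 fxy mdistxx.
Qed.

Lemma Iso_ext (f g : Iso) : f =1 g -> f = g.
Proof.
case: f g => [f Pf] [g Pg] /= /funext fg; case: _ / fg Pg => Pg.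
by congr MkIso; exact: Prop_irrelevance.
Qed.

HB.instance Definition _ := gen_eqMixin Iso.
HB.instance Definition _ := gen_choiceMixin Iso.

Lemma iso1_subproof : is_isometry (@idfun X).
Proof. by split=> // y; exists y. Qed.

Lemma isoM_subproof (f g : Iso) : is_isometry (f \o g).
Proof.
split=> [x y|z] /=; first by rewrite (isoP f).1 (isoP g).1.
have [y <-] := (isoP f).2 z; have [x <-] := (isoP g).2 y.
by exists x.
Qed.

Definition iso_inv_fun (f : Iso) (y : X) : X := projT1 (cid ((isoP f).2 y)).

Lemma iso_inv_funK (f : Iso) : cancel (iso_inv_fun f) f.
Proof. by move=> y; rewrite /iso_inv_fun; case: cid. Qed.

Lemma isoV_subproof (f : Iso) : is_isometry (iso_inv_fun f).
Proof.
split=> [x y|x]; first by rewrite -(isoP f).1 !iso_inv_funK.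
by exists (f x); apply: (iso_inj (f := f)); rewrite iso_inv_funK.
Qed.

Definition iso1 := MkIso iso1_subproof.
Definition isoM (f g : Iso) := MkIso (isoM_subproof f g).
Definition isoV (f : Iso) := MkIso (isoV_subproof f).

Lemma isoMA : associative isoM. Proof. by move=> f g h; exact: Iso_ext. Qed.
Lemma iso1M : left_id iso1 isoM. Proof. by move=> f; exact: Iso_ext. Qed.
Lemma isoM1 : right_id iso1 isoM. Proof. by move=> f; exact: Iso_ext. Qed.
Lemma isoMV : right_inverse iso1 isoV isoM.
Proof. by move=> f; apply: Iso_ext => x /=; rewrite iso_inv_funK. Qed.
Lemma isoVM : left_inverse iso1 isoV isoM.
Proof.
by move=> f; apply: Iso_ext => x /=; apply: (@iso_inj f); rewrite iso_inv_funK.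
Qed.

HB.instance Definition _ := isGroup.Build Iso
  isoMA iso1M isoM1 isoVM isoMV.

HB.instance Definition _ := Topological.copy Iso
  (initial_topology (iso_fun : Iso -> {ptws X -> X})).

Lemma Iso_cvgP (F : set_system Iso) (f : Iso) : Filter F ->
  F --> f <-> forall x : X, (fun g : Iso => g x) @ F --> f x.
Proof.
move=> FF; have ptwsE : iso_fun @ F --> (iso_fun f : {ptws X -> X}) <->
    forall x : X, (fun g : Iso => g x) @ F --> f x by exact: pointwise_cvgP.
split=> [Ff|/ptwsE {}Ff].
  apply/ptwsE.
  exact: (@cvg_comp _ _ _ id (iso_fun : Iso -> {ptws X -> X}) F _ _ Ff
    (@initial_continuous _ _ (iso_fun : Iso -> {ptws X -> X}) f)).
move=> A [_ [[W oW <-] Wf] WA]; apply: filterS WA _.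
by apply: Ff; exact: open_nbhs_nbhs.
Qed.

Lemma Iso_mul_continuous : continuous (fun p : Iso * Iso => (p.1 * p.2)%g).
Proof.
move=> [f g]; apply/Iso_cvgP => x; apply/cvg_ballP => e e0.
have e2 : 0 < e / 2 by rewrite divr_gt0.
have /Iso_cvgP/(_ (g x))/cvg_ballP/(_ _ e2) fP : nbhs f --> f by [].
have /Iso_cvgP/(_ x)/cvg_ballP/(_ _ e2) gP : nbhs g --> g by [].
exists ([set h : Iso | ball (f (g x)) (e / 2) (h (g x))],
        [set h : Iso | ball (g x) (e / 2) (h x)]); first by split.
move=> -[h k] /= [hP kP]; apply: (ball_split hP).
by move: kP; rewrite !ballEmdist /= (isoP h).1.
Qed.

Lemma Iso_inv_continuous : continuous (fun f : Iso => (f^-1)%g).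
Proof.
move=> f; have Ff : Filter (nbhs f) := nbhs_filter f.
apply/Iso_cvgP => x; apply/cvg_ballP => e e0.
pose y := (f^-1)%g x.
have fy : f y = x by exact: iso_inv_funK.
have /Iso_cvgP/(_ y)/cvg_ballP/(_ _ e0) : nbhs f --> f by [].
apply: filterS => h /=; rewrite !ballEmdist /= fy metric_sym => hxy.
by rewrite -/y -(isoP h).1 (iso_inv_funK h).
Qed.

HB.instance Definition _ := isTopologicalGroup.Build Iso
  Iso_mul_continuous Iso_inv_continuous.

End IsometryGroup.

Definition omega_homogeneous (R : realType) (X : metricType R) : Prop :=
  forall (A B : {fset X}) (f : A -> B), is_isometry f ->
    exists g : Iso X, forall x : A, g (val x) = val (f x).

Section Embeddings.
Context {R : realType} {X : metricType R} (F : {fset X}).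

Record embedding := MkEmbedding {
  emb_fun :> F -> X ;
  embP : isometric_embedding emb_fun
}.

Lemma embedding_ext (i j : embedding) : i =1 j -> i = j.
Proof.
case: i j => [i Pi] [j Pj] /= /funext ij; case: _ / ij Pj => Pj.
by congr MkEmbedding; exact: Prop_irrelevance.
Qed.

HB.instance Definition _ := gen_eqMixin embedding.
HB.instance Definition _ := gen_choiceMixin embedding.

Definition dsup (i j : embedding) : R :=
  \big[Num.max/0]_(x : F) mdist (i x) (j x).

Lemma dsupxx i : dsup i i = 0.
Proof. by apply: big1_idem => [|x _]; [exact: maxxx|exact: mdistxx]. Qed.

Lemma le_dsup (i j : embedding) (x : F) : mdist (i x) (j x) <= dsup i j.
Proof. exact: le_bigmax. Qed.

Lemma dsup_eq0 i j : dsup i j = 0 -> i = j.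
Proof.
move=> ij0; apply: embedding_ext => x; apply: mdist_positivity.
by apply/eqP; rewrite eq_le mdist_ge0 -ij0 le_dsup.
Qed.

Lemma dsup_sym i j : dsup i j = dsup j i.
Proof. by apply: eq_bigr => x _; exact: metric_sym. Qed.

Lemma dsup_triangle j i k : dsup i k <= dsup i j + dsup j k.
Proof.
apply: bigmax_le => [|x _].
  by rewrite addr_ge0//; exact: bigmax_ge_id.
by rewrite (le_trans (metric_triangle _ (j x) _))// lerD// le_dsup.
Qed.

HB.instance Definition _ := @isMetric.Build R embedding dsup
  dsupxx dsup_eq0 dsup_sym dsup_triangle.

End Embeddings.

Definition colouring (Y : Type) (gamma : set (set Y)) : Prop :=
  finite_set gamma /\ partition gamma id [set: Y].

Definition monochromatic_upto (R : realType) (Y : metricType R)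
    (gamma : set (set Y)) (e : R) (Z : set Y) : Prop :=
  exists2 A, gamma A & Z `<=` [set z | exists2 y, A y & mdist y z < e].

Definition isometric_copy (R : realType) (X : metricType R)
    (G G' : {fset X}) : Prop :=
  exists f : G -> G', is_isometry f.

Definition factors_through (R : realType) (X : metricType R) (F G' : {fset X}) :
    set (embedding F) :=
  [set i | forall x, i x \in G'].

Arguments factors_through {R X} F G'.

(* Main.v *)
Require Import Defs.
From HB Require Import structures.
From mathcomp Require Import all_boot all_order all_algebra finmap.
From mathcomp Require Import all_classical all_reals all_analysis.
From mathcomp Require Import lra.
Import Order.TTheory GRing.Theory Num.Theory numFieldNormedType.Exports.
Local Open Scope classical_set_scope.
Local Open Scope ring_scope.

(** Write H for the isometry group of X. By omega-homogeneity H acts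
transitively on the embeddings of F ([embedding_transitive]), so embeddings of
F are the cosets of the pointwise stabiliser of F, and the metric on embeddings
records how far an isometry is from that stabiliser. This lets one pass between
colourings of embeddings and compact spaces on which H acts.

From extreme amenability to the colouring property: suppose a colouring gamma,
a finite G and e > 0 admit no good copy of G. The distances to the colours,
truncated at e, form a point of the space of [0, e]-valued 1-Lipschitz
labellings of embeddings and colours which vanish at some colour for each
embedding, and for which every copy of G carries, for each colour, an embedding
labelled at least e. Each of these conditions is closed and H-invariant, so
this is a compact space on which H acts ([labellings_compact],
[shift_labellings]); the Lipschitz bound makes the action jointly continuous
([shift_continuous]). A fixed point is constant on embeddings by transitivity,
so some colour is labelled at most 0 everywhere, although some embedding
through G must be labelled at least e for that colour: a contradiction
([extremely_amenable_ramsey]).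

From the colouring property to extreme amenability: suppose H acts on a compact
Hausdorff space K without fixed point. Urysohn functions and compactness give
finitely many pairs of an isometry g and a continuous f such that each y in K
satisfies |f y - f (g y)| > 1/2 for one of them ([separating_family]). By
compactness, isometries moving the points of a suitable finite F by less than
some d change these functions by less than 1/8 uniformly on K ([action_near1],
[nbhs_Iso1]). Hence, for a base point x0, the value of f at h^-1 x0 depends,
up to 1/8, only on the restriction of h to F. Colour an embedding of F by a
point of a finite net of K near the corresponding h^-1 x0 ([finite_net]), and
let G be the union of F and its finitely many translates g^-1 F. If p moves G
to a copy on which the colouring is constant up to d, then h = p and
h = p g^-1 give points y and g y, where y = p^-1 x0, with f y and f (g y)
within 1/2 for all pairs: a contradiction ([ramsey_extremely_amenable]). *)

Set Implicit Arguments.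
Unset Strict Implicit.
Unset Printing Implicit Defensive.

(** * Isometries acting on embeddings *)

Section Isometries.
Context (R : realType) (X : metricType R).
Implicit Types (F G : {fset X}) (g h : Iso X).

Lemma Iso_mulE g h (x : X) : (g * h)%g x = g (h x).
Proof. by []. Qed.

Lemma Iso_invVK g (x : X) : g ((g^-1)%g x) = x.
Proof. by rewrite -Iso_mulE mulgV. Qed.

Lemma comp_embedding_subproof F g (i : embedding F) :
  isometric_embedding (g \o i).
Proof. by move=> x y /=; rewrite (isoP g).1 (embP i). Qed.

Definition comp_embedding F g (i : embedding F) : embedding F :=
  MkEmbedding (comp_embedding_subproof g i).

Lemma inclusion_subproof F : isometric_embedding (fun x : F => val x).
Proof. by []. Qed.

Definition inclusion F : embedding F := MkEmbedding (@inclusion_subproof F).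

Lemma comp_embedding1 F (i : embedding F) : comp_embedding 1%g i = i.
Proof. exact: embedding_ext. Qed.

Lemma comp_embeddingM F g h (i : embedding F) :
  comp_embedding (g * h)%g i = comp_embedding g (comp_embedding h i).
Proof. exact: embedding_ext. Qed.

Lemma dsup_ltP F (i j : embedding F) (e : R) : 0 < e ->
  (forall x, mdist (i x) (j x) < e) -> mdist i j < e.
Proof. by move=> e0 ij; apply: bigmax_lt. Qed.

Lemma lt_dsup F (i j : embedding F) (e : R) :
  mdist i j < e -> forall x, mdist (i x) (j x) < e.
Proof. by move=> ij x; apply: le_lt_trans ij; exact: le_dsup. Qed.

Lemma dist_comp_embedding F g (i j : embedding F) :
  mdist (comp_embedding g i) (comp_embedding g j) = mdist i j.
Proof. by apply: eq_bigr => x _; rewrite /= (isoP g).1. Qed.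

(** The image of an embedding is a finite subspace isometric to F, so
omega-homogeneity extends the embedding itself to an isometry of X. *)
Lemma embedding_transitive F (i : embedding F) : omega_homogeneous X ->
  exists g, i = comp_embedding g (inclusion F).
Proof.
move=> homX; pose B := [fset i x | x : F]%fset.
have iB x : i x \in B by apply/imfsetP; exists x.
have [|g gE] := homX F B (fun x => [` iB x]%fset).
  split=> [x y|[y yB]]; first exact: (embP i).
  have /imfsetP[x _ yE] := yB; exists x; exact: val_inj.
by exists g; apply: embedding_ext => x /=; rewrite gE.
Qed.

Lemma isometric_copy_extends G G' : omega_homogeneous X ->
  isometric_copy G G' -> exists p : Iso X, forall x, x \in G -> p x \in G'.
Proof.
move=> homX [m [md _]].
have mX : isometric_embedding (val \o m) by move=> x y; rewrite -md.
have [p pE] := embedding_transitive (MkEmbedding mX) homX.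
exists p => x xG; have := congr1 (fun i : embedding G => i [` xG]%fset) pE.
by rewrite /= => <-; exact: valP.
Qed.

Lemma isometric_copy_image G G' g : isometric_copy G G' ->
  isometric_copy G [fset g x | x in G']%fset.
Proof.
move=> [f [fd fs]].
have fB x : g (val (f x)) \in [fset g x | x in G']%fset.
  by apply/imfsetP; exists (val (f x)) => //=; exact: valP.
exists (fun x => [` fB x]%fset); split=> [x y|[z zB]].
  by rewrite -fd; exact: (isoP g).1.
have /imfsetP[y /= yG' zE] := zB; have [x fx] := fs [` yG']%fset.
by exists x; apply: val_inj; rewrite /= fx zE.
Qed.

(** The sets on the right form a filter base converging pointwise to the
identity. Convergence in the group is pointwise convergence, so the filter they
generate contains every neighbourhood of 1. *)
Lemma nbhs_Iso1 (V : set (Iso X)) : nbhs (1%g : Iso X) V ->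
  exists F (d : R), 0 < d /\
    forall h, (forall x, x \in F -> mdist (h x) x < d) -> V h.
Proof.
pose B (Fd : {fset X} * R) := [set h : Iso X |
  forall x, x \in Fd.1 -> mdist (h x) x < Fd.2].
pose U := filter_from [set Fd : {fset X} * R | 0 < Fd.2] B.
have FU : Filter U.
  apply: filter_from_filter; first by exists (fset0, 1) => /=.
  move=> [F d] [F' d'] /= d0 d'0; exists (F `|` F', Num.min d d')%fset => /=.
    by rewrite lt_min d0.
  move=> h Bh; split=> x xF; have := Bh x; rewrite /= in_fsetU xF ?orbT;
  by move=> /(_ isT); rewrite lt_min => /andP[].
have Ucvg : U --> (1%g : Iso X).
  apply/Iso_cvgP => x; apply/cvg_ballP => e e0.
  exists ([fset x]%fset, e) => // h /= /(_ x).
  rewrite in_fset1 eqxx => /(_ isT).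
  by rewrite ballEmdist /= metric_sym.
by move=> /Ucvg[[F d] /= d0 BV]; exists F, d; split.
Qed.

End Isometries.

(** * Uniform estimates for actions on compact spaces *)

(** The near-covering form of compactness, applied to the filter of all large
enough finite sets D: a set D containing x covers every y in V x. *)
Lemma compact_finite_cover (K : topologicalType) (V : K -> set K) :
  compact [set: K] -> (forall x, nbhs x (V x)) ->
  exists D : {fset K}, forall y, exists2 x, x \in D & V x y.
Proof.
move=> /compact_near_coveringP cK nV.
pose U := filter_from [set: {fset K}] (fun D => [set D' | (D `<=` D')%fset]).
have FU : Filter U.
  apply: filter_from_filter; first by exists fset0.
  move=> D D' _ _; exists (D `|` D')%fset => // E /=.
  by rewrite fsubUset => /andP[].
have [x _|D _ Dcov] := cK _ U (fun D y => exists2 x, x \in D & V x y) FU.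
  exists (V x, [set D | x \in D]) => /=; last first.
    by move=> [y D] [/= Vy xD]; exists x.
  by split=> //; exists [fset x]%fset => // D /=; rewrite fsub1set.
exists D => y; exact: (Dcov D (fsubset_refl _) y I).
Qed.

Section CompactActions.
Context (G : topologicalGroupType) (K : topologicalType) (a : G -> K -> K).
Context (R : realType).
Context (Kcompact : compact [set: K]) (aP : continuous_action a).

(** Joint continuity at each (1, y) gives the estimate near y, and compactness
makes the neighbourhood of 1 independent of y. *)
Lemma action_near1 (f : K -> R) (e : R) : continuous f -> 0 < e ->
  \forall h \near (1%g : G), forall y, `|f (a h y) - f y| < e.
Proof.
move=> cf e0; have [a1 aM ac] := aP.
have /compact_near_coveringP cK := Kcompact.
suff : \forall h \near (1%g : G),
    [set: K] `<=` (fun y => `|f (a h y) - f y| < e).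
  by apply: filterS => h sub y; exact: sub.
apply: cK => x _.
have e2 : 0 < e / 2 by rewrite divr_gt0.
have c1 : (fun p : G * K => f (a p.1 p.2)) @ (1%g, x) --> f x.
  rewrite -{2}(a1 x); apply: (cvg_comp _ _ (ac (1%g, x))); exact: cf.
have /cvgrPdist_lt/(_ _ e2)[[U V] /= [U1 Vx] UV] := c1.
have /cvgrPdist_lt/(_ _ e2) Wx := cf x.
exists (V `&` [set y | `|f x - f y| < e / 2], U) => /=.
  by split => //; exact: filterI.
move=> [y h] /= [[Vy fy] Uh].
have /= ? := UV (h, y) (conj Uh Vy).
have -> : f (a h y) - f y = (f x - f y) - (f x - f (a h y)) by lra.
by rewrite (le_lt_trans (ler_normB _ _))// (splitr e) ltrD.
Qed.

(** A compact Hausdorff space is completely regular, so each x comes with a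
continuous function separating x from some translate g x; by continuity the
same pair works near x, and finitely many x suffice. *)
Lemma separating_family : hausdorff_space K ->
  ~ (exists x, forall g, a g x = x) ->
  exists (D : {fset K}) (g : K -> G) (f : K -> K -> R),
    (forall x, continuous (f x)) /\
    forall y, exists2 x, x \in D & 1 / 2 < `|f x y - f x (a (g x) y)|.
Proof.
move=> Khaus nofix; have [a1 aM ac] := aP.
have acg h : continuous (a h).
  by move=> x; apply: cvg_comp2 (ac (h, x)); [exact: cvg_cst|exact: cvg_id].
have cr : completely_regular_space K.
  apply: (@normal_completely_regular R); first exact: compact_normal.
  exact: hausdorff_accessible.
have moved x : exists gf : G * (K -> R), continuous gf.2 /\
    1 / 2 < `|gf.2 x - gf.2 (a gf.1 x)|.
  have [g gx] : exists g, a g x <> x.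
    by apply/existsNP => fixx; apply: nofix; exists x.
  have /uniform_separatorP : @uniform_separator K [set x] [set a g x].
    apply: cr; last by move=> /esym.
    exact/accessible_closed_set1/hausdorff_accessible.
  move=> /(_ R)[f [cf _ f0 f1]]; exists (g, f); split=> //=.
  have -> : f x = 0 by apply: f0; exists x.
  have -> : f (a g x) = 1 by apply: f1; exists (a g x).
  by rewrite sub0r normrN normr1; lra.
have [gf gfP] := choice moved.
pose f x := (gf x).2; pose g x := (gf x).1.
have cf x : continuous (f x) by exact: (gfP x).1.
have [x|D Dcov] := compact_finite_cover
    (V := fun x => [set y | 1 / 2 < `|f x y - f x (a (g x) y)|]) Kcompact.
  have cd : {for x, continuous (fun y => `|f x y - f x (a (g x) y)|)}.
    apply: cvg_norm; apply: cvgB; first exact: cf.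
    by apply: (cvg_comp _ _ (acg _ x)); exact: cf.
  exact: (cvgr_gt _ cd _ (gfP x).2).
by exists D, g, f.
Qed.

Lemma finite_net (I : choiceType) (D : {fset I}) (f : I -> K -> R) (e : R) :
  0 < e ->
  (forall x, continuous (f x)) ->
  exists N : {fset K}, forall y, exists2 c, c \in N &
    forall x, x \in D -> `|f x c - f x y| < e.
Proof.
move=> e0 cf.
pose V c := \bigcap_(x in [set` D]) [set y | `|f x c - f x y| < e].
have [c|N Ncov] := compact_finite_cover (V := V) Kcompact.
  by apply: filter_bigI => x _; have /cvgrPdist_lt := cf x c; exact.
by exists N.
Qed.

End CompactActions.

(** * From colourings to fixed points *)

Lemma preimage_colouring (Y T : Type) (c : Y -> T) :
  finite_set (range c) -> colouring [set c @^-1` [set t] | t in range c].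
Proof.
move=> fc; split; first exact: finite_image.
split=> [|_ _ [t _ <-] [u _ <-] [y [/= <- <-]]|_ [_ [y _ <-] <-]].
- apply/seteqP; split=> // y _; exists (c @^-1` [set c y]) => //.
  by exists (c y) => //; exists y.
- by [].
- by exists y.
Qed.

Lemma ramsey_extremely_amenable (R : realType) (X : metricType R) :
  omega_homogeneous X ->
  (forall (F : {fset X}) (gamma : set (set (embedding F))),
     colouring gamma ->
     forall (G : {fset X}) (e : R), 0 < e ->
       exists2 G' : {fset X}, isometric_copy G G' &
         monochromatic_upto gamma e (factors_through F G')) ->
  extremely_amenable (Iso X).
Proof.
move=> homX ramsey K a [x0 _] Kcompact Khaus aP; have [a1 aM _] := aP.
apply: contrapT => nofix.
have [D [g [f [fc fsep]]]] := separating_family R Kcompact aP Khaus nofix.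
(* Comparing f y with f (g y) takes four steps of size 1/8: from each of the
   two values to the value at the point q of a nearby embedding, and from there
   to the net point which is the common colour. *)
have e0 : 0 < 1 / 8 :> R by lra.
have [N Nnet] := finite_net Kcompact D e0 fc.
have : \forall h \near (1%g : Iso X), forall x, x \in D ->
    forall y, `|f x (a h y) - f x y| < 1 / 8.
  exact: filter_bigI (fun x _ => action_near1 Kcompact aP (fc x) e0).
move=> /nbhs_Iso1[F [d [d0 small]]].
have [lift liftE] :=
  choice (fun i : embedding F => embedding_transitive i homX).
pose q i := a (lift i)^-1%g x0.
have qP (h : Iso X) i x : mdist i (comp_embedding h (inclusion F)) < d ->
    x \in D -> `|f x (a h^-1%g x0) - f x (q i)| < 1 / 8.
  move=> hi xD.
  (* h^-1 (lift i) almost fixes F pointwise, as h and lift i almost agree there,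
     and it sends q i to h^-1 x0. *)
  have -> : a h^-1%g x0 = a (h^-1 * lift i)%g (q i).
    by rewrite /q -aM -mulgA mulgV mulg1.
  apply: small => // y yF; have := lt_dsup hi [` yF]%fset.
  rewrite {1}[i]liftE /= => {}hi.
  by move: hi; rewrite -{1}(Iso_invVK h (lift i y)) (isoP h).1.
have cP i : exists c, c \in N /\
    forall x, x \in D -> `|f x c - f x (q i)| < 1 / 8.
  by have [c cN cD] := Nnet (q i); exists c.
have [c {}cP] := choice cP.
pose G := (F `|` [fset (g x)^-1%g y | x in D, y in F])%fset.
have gammaP : colouring [set c @^-1` [set t] | t in range c].
  apply: preimage_colouring; apply: (sub_finite_set _ (finite_fset N)).
  by move=> _ [i _ <-]; exact: (cP i).1.
have [G' GG' [_ [t _ <-] mono]] := ramsey F _ gammaP G d d0.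
have [p pG] := isometric_copy_extends homX GG'.
have through (h : Iso X) x : (forall y, y \in F -> h y \in G) -> x \in D ->
    `|f x (a h^-1%g (a p^-1%g x0)) - f x t| < 1 / 4.
  move=> hF xD.
  have [|i /= ci ihd] := mono (comp_embedding (p * h)%g (inclusion F)).
    by move=> y /=; apply/pG/hF/valP.
  have := qP _ _ _ ihd xD; have := (cP i).2 x xD.
  rewrite ci invgM aM !ltr_norml; lra.
have [x xD] := fsep (a p^-1%g x0).
(* h = 1 gives the value at y = p^-1 x0, and h = (g x)^-1 the value at g x y. *)
have := through 1%g x _ xD; rewrite invg1 a1 => /(_ _)/wrap[y yF|].
  by rewrite in_fsetU yF.
have := through (g x)^-1%g x _ xD; rewrite invgK => /(_ _)/wrap[y yF|].
  rewrite in_fsetU; apply/orP; right.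
  by apply/imfset2P; exists x => //; exists y.
rewrite !ltr_norml; move=> /andP[? ?] /andP[? ?].
apply/negP; rewrite -leNgt ler_norml; apply/andP; split; lra.
Qed.

(** * Invariant compact sets *)

Lemma compact_set_type (T : topologicalType) (K : set T) :
  compact K -> compact [set: set_type K].
Proof.
move=> /compact_near_coveringP cK; apply/compact_near_coveringP => I F P FF nP.
have /(_ _)/wrap[x Kx|] :=
  cK I F (fun i x => forall Kx : x \in K, P i (exist _ x Kx)) FF.
  have [[V W] /= [Vx FW] VW] := nP (exist _ x (mem_set Kx)) Logic.I.
  have [_ [[U oU <-] /= Ux UV]] := Vx.
  exists (U, W) => /=; first by split => //; exact: open_nbhs_nbhs.
  move=> [y i] /= [Uy Wi] Ky; apply: (VW (exist _ y Ky, i)).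
  by split => //; exact: UV.
by apply: filterS => i Pi [y Ky] _; apply: Pi; exact: set_mem.
Qed.

(** Actions on a space of functions are defined on all functions but continuous
on a compact invariant set only, whence the restriction of the second filter
to K. *)
Lemma fixed_point_in_compact (G : topologicalGroupType) (T : topologicalType)
    (K : set T) (a : G -> T -> T) :
  extremely_amenable G -> hausdorff_space T -> compact K -> K !=set0 ->
  (forall g x, K x -> K (a g x)) ->
  (forall x, a 1%g x = x) -> (forall g h x, a (g * h)%g x = a g (a h x)) ->
  (forall g x, K x ->
     (fun p => a p.1 p.2) @ filter_prod (nbhs g) (within K (nbhs x))
       --> a g x) ->
  exists2 x, K x & forall g, a g x = x.
Proof.
move=> eaG hT cK [x0 Kx0] aK a1 aM ac.
pose b g (x : set_type K) : set_type K :=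
  exist _ (a g (val x)) (mem_set (aK g _ (set_mem (valP x)))).
have [||||x xfix] := eaG (set_type K) b.
- by exists (exist _ x0 (mem_set Kx0)).
- exact: compact_set_type.
- move=> x y xy; apply: val_inj; apply: hT => A B nA nB.
  have [z [Az Bz]] := xy _ _ (@initial_continuous _ _ (@set_val _ K) x _ nA)
    (@initial_continuous _ _ (@set_val _ K) y _ nB).
  by exists (val z).
- split=> [x|g h x|[g x] V]; [exact/val_inj/a1|exact/val_inj/aM|].
  move=> [_ [[N oN <-] /= Nx NV]].
  have nN : nbhs (a g (val x)) N by exact: open_nbhs_nbhs.
  have [[U W] /= [nU nW] UW] := ac g (val x) (set_mem (valP x)) N nN.
  exists (U, set_val @^-1` W) => /=.
    split=> //; have nW' : nbhs x (set_val @^-1` [set y | K y -> W y]).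
      exact: (@initial_continuous _ _ (@set_val _ K) x _ nW).
    by apply: filterS nW' => y; apply; exact: set_mem (valP y).
  by move=> [h y] /= [Uh Wy]; apply: NV; apply: (UW (h, val y)); split.
exists (val x) => [|g]; first exact: set_mem (valP x).
by have /(congr1 (@sval _ _)) := xfix g.
Qed.

Lemma ptws_cvg (I : Type) (T : topologicalType) (F : set_system {ptws I -> T})
    (f : {ptws I -> T}) : Filter F ->
  (forall i, (fun g : {ptws I -> T} => g i) @ F --> f i) -> F --> f.
Proof.
move=> FF Ff; apply/cvg_sup => i V [_ [[W oW <-] /= Wf] WV].
by apply: filterS WV _; apply: (Ff i); exact: open_nbhs_nbhs.
Qed.

(** * From fixed points to colourings *)

Section TruncatedDistance.
Context (R : realType) (Y : metricType R) (e : R) (A : set Y).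
Context (e0 : 0 <= e).

(** The minimum of e and the distance to A; putting e into the set makes the
infimum that of a nonempty set even when A is empty. *)
Definition truncated_dist (y : Y) : R := inf (e |` [set mdist y z | z in A]).

Lemma truncated_dist_lb (y : Y) (r : R) : r <= e ->
  (forall z, A z -> r <= mdist y z) -> r <= truncated_dist y.
Proof.
move=> re rA; apply: lb_le_inf; first by exists e; left.
by move=> _ [->|[z Az <-]] //; exact: rA.
Qed.

Let has_lb (y : Y) : has_lbound (e |` [set mdist y z | z in A]).
Proof. by exists 0 => _ [->|[z _ <-]] //; exact: mdist_ge0. Qed.

Lemma truncated_dist_ge0 y : 0 <= truncated_dist y.
Proof. by apply: truncated_dist_lb => // z _; exact: mdist_ge0. Qed.

Lemma truncated_dist_le y : truncated_dist y <= e.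
Proof. by apply: ge_inf => //; left. Qed.

Lemma truncated_dist_le_mdist y z : A z -> truncated_dist y <= mdist y z.
Proof. by move=> Az; apply: ge_inf => //; right; exists z. Qed.

Lemma truncated_dist0 y : A y -> truncated_dist y = 0.
Proof.
move=> Ay; apply/eqP; rewrite eq_le truncated_dist_ge0 andbT.
by rewrite -(mdistxx y) truncated_dist_le_mdist.
Qed.

Lemma truncated_dist_lip y z : truncated_dist y <= truncated_dist z + mdist y z.
Proof.
rewrite -lerBlDr; apply: truncated_dist_lb => [|w Aw].
  by rewrite lerBlDr (le_trans (truncated_dist_le y))// lerDl mdist_ge0.
rewrite lerBlDl (le_trans (truncated_dist_le_mdist y Aw))//.
exact: metric_triangle.
Qed.

End TruncatedDistance.

Lemma finite_factors_through (R : realType) (X : metricType R)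
    (F G : {fset X}) :
  finite_set (factors_through F G).
Proof.
pose code (i : embedding F) : {ffun F -> option G} := [ffun x => insub (i x)].
have code_inj : {in factors_through F G &, injective code}.
  move=> i j /set_mem iG /set_mem jG ij; apply: embedding_ext => x.
  have := congr1 (fun f : {ffun F -> option G} => f x) ij.
  rewrite !ffunE; case: insubP => [u _ <-|]; last by rewrite iG.
  by case: insubP => [v _ <- [->]|]; last by rewrite jG.
by rewrite -(eq_finite_set (inj_card_eq code_inj)); exact: finite_finset.
Qed.

(** Pointwise convergence of isometries is uniform on the finite image of i. *)
Lemma comp_embedding_continuous (R : realType) (X : metricType R) (F : {fset X})
  (i : embedding F) : continuous (fun g : Iso X => comp_embedding g i).
Proof.
move=> g; have Fg : Filter (nbhs g) := nbhs_filter g.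
apply/cvg_ballP => d d0.
have near_at x : nbhs g [set h : Iso X | mdist (g (i x)) (h (i x)) < d].
  have /Iso_cvgP/(_ (i x))/cvg_ballP/(_ _ d0) : nbhs g --> g by [].
  by rewrite ballEmdist.
have : nbhs g [set h : Iso X | forall x, mdist (g (i x)) (h (i x)) < d].
  exact: (@filter_forall _ _ _ _ Fg near_at).
by apply: filterS => h hx; rewrite /= ballEmdist; exact: dsup_ltP.
Qed.

Section RamseyFlow.
Context (R : realType) (X : metricType R) (F G : {fset X}).
Context (gamma : set (set (embedding F))) (e : R).
Context (gammaP : colouring gamma).

Local Notation labelling := {ptws embedding F * set (embedding F) -> R}.

(** Labellings that look like the truncated distances to the colours of a
colouring for which no copy of G is monochromatic up to e. The upper bound
phi (i, A) <= 0 is equality, written so as to be a half-space. *)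
Definition labellings : set labelling :=
  [set phi : labelling | [/\ forall p, 0 <= phi p <= e,
     forall i j A, phi (i, A) - phi (j, A) <= mdist i j,
     forall i, exists2 A, gamma A & phi (i, A) <= 0
   & forall G', isometric_copy G G' -> forall A, gamma A ->
       exists2 i, factors_through F G' i & e <= phi (i, A)]].

Definition shift (g : Iso X) (phi : labelling) : labelling :=
  fun p => phi (comp_embedding g^-1%g p.1, p.2).

Lemma eval_continuous p : continuous (fun phi : labelling => phi p).
Proof. exact: (@proj_continuous _ (fun=> R) p). Qed.

(** A closed subset of a cube: the existential conditions stay closed because
there are finitely many colours, and finitely many embeddings of F through a
given finite subspace. *)
Lemma labellings_compact : compact labellings.
Proof.
have ev := eval_continuous.
have box : compact [set phi : labelling | forall p, `[0, e]%classic (phi p)].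
  apply: (@tychonoff _ (fun=> R) (fun=> `[0, e]%classic)) => p.
  exact: segment_compact.
apply: (subclosed_compact _ box); last first.
  by move=> phi [phie _ _ _] p /=; rewrite in_itv /=; exact: phie.
have evB p q : continuous (fun phi : labelling => phi p - phi q).
  by move=> phi; exact: (cvgB (ev p phi) (ev q phi)).
have closed_ev_le p c : closed [set phi : labelling | phi p <= c].
  have /continuous_closedP closed_ev := ev p.
  exact: (closed_ev [set r | r <= c] (@closed_le R c)).
have closed_ev_ge p c : closed [set phi : labelling | c <= phi p].
  have /continuous_closedP closed_ev := ev p.
  exact: (closed_ev [set r | c <= r] (@closed_ge R c)).
have closed_evB p q c : closed [set phi : labelling | phi p - phi q <= c].
  have /continuous_closedP closed_ev := evB p q.
  exact: (closed_ev [set r | r <= c] (@closed_le R c)).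
have -> : labellings =
    (\bigcap_p ([set phi | 0 <= phi p] `&` [set phi | phi p <= e])) `&`
    (\bigcap_i \bigcap_j \bigcap_A
       [set phi | phi (i, A) - phi (j, A) <= mdist i j]) `&`
    (\bigcap_i \bigcup_(A in gamma) [set phi | phi (i, A) <= 0]) `&`
    (\bigcap_(G' in [set G' | isometric_copy G G']) \bigcap_(A in gamma)
       \bigcup_(i in factors_through F G') [set phi | e <= phi (i, A)]).
  apply/seteqP; split=> [phi [h1 h2 h3 h4]|phi [[[h1 h2] h3] h4]].
    split; first split; first split.
    - by move=> p _; apply/andP; exact: h1.
    - by move=> i _ j _ A _; exact: h2.
    - by move=> i _; exact: h3.
    - by move=> G' GG' A gA; exact: h4.
  split.
  - by move=> p; apply/andP; exact: h1.
  - by move=> i j A; exact: h2.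
  - by move=> i; exact: h3.
  - by move=> G' GG' A gA; exact: h4.
apply: closedI; first apply: closedI; first apply: closedI.
- by apply: closed_bigI => p _; exact: closedI.
- by do 3![apply: closed_bigI => ? _].
- apply: closed_bigI => i _; apply: closed_bigcup; first exact: gammaP.1.
  by move=> A _.
- apply: closed_bigI => G' _; apply: closed_bigI => A _.
  by apply: closed_bigcup; [exact: finite_factors_through|move=> i _].
Qed.

Lemma shift1 phi : shift 1%g phi = phi.
Proof.
by apply: funext => -[i A]; rewrite /shift /= invg1 comp_embedding1.
Qed.

Lemma shiftM g h phi : shift (g * h)%g phi = shift g (shift h phi).
Proof.
by apply: funext => -[i A]; rewrite /shift /= invgM comp_embeddingM.
Qed.

(** The last condition is preserved because g^-1 maps copies of G to copies
of G. *)
Lemma shift_labellings g phi : labellings phi -> labellings (shift g phi).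
Proof.
move=> [h1 h2 h3 h4]; split=> [p|i j A|i|G' GG' A gA]; first exact: h1.
- by rewrite -(dist_comp_embedding g^-1%g); exact: h2.
- exact: (h3 (comp_embedding g^-1%g i)).
have [i iG' ei] := h4 _ (isometric_copy_image g^-1%g GG') A gA.
exists (comp_embedding g i).
  move=> x /=; have /imfsetP[y /= yG' ->] := iG' x.
  by rewrite Iso_invVK.
by rewrite /shift /= -comp_embeddingM mulVg comp_embedding1.
Qed.

(** At (i, A), moving g costs at most the distance between the two preimages of
i, uniformly over the 1-Lipschitz labellings; moving phi is then only felt at
the single point (g^-1 i, A). *)
Lemma shift_continuous g phi : labellings phi ->
  (fun p => shift p.1 p.2) @ filter_prod (nbhs g) (within labellings (nbhs phi))
  --> shift g phi.
Proof.
move=> phiK; have Fg : Filter (nbhs g) := nbhs_filter g.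
apply: ptws_cvg => -[i A]; apply/cvgrPdist_lt => d d0.
have d2 : 0 < d / 2 by rewrite divr_gt0.
pose j := comp_embedding g^-1%g i.
have nU : nbhs g [set h : Iso X | mdist j (comp_embedding h^-1%g i) < d / 2].
  have cU : (fun h : Iso X => comp_embedding h^-1%g i) @ g --> j.
    exact: (cvg_comp _ (fun h => comp_embedding h i)
      (@invg_continuous (Iso X) g) (@comp_embedding_continuous _ _ _ i _)).
  by have /cvg_ballP/(_ _ d2) := cU; rewrite ballEmdist.
have nW : nbhs phi [set psi : labelling | `|phi (j, A) - psi (j, A)| < d / 2].
  by have /cvgrPdist_lt/(_ _ d2) := @eval_continuous (j, A) phi.
exists ([set h : Iso X | mdist j (comp_embedding h^-1%g i) < d / 2],
  labellings `&` [set psi | `|phi (j, A) - psi (j, A)| < d / 2]) => /=.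
  by split=> //; apply: filterS nW.
move=> [h psi] /= [hU [[_ psi_lip _ _] psiW]]; rewrite /shift /= -/j.
set k := comp_embedding h^-1%g i in hU *.
have := psi_lip j k A; have := psi_lip k j A; rewrite (metric_sym k j).
move: hU psiW; rewrite !ltr_norml; lra.
Qed.

End RamseyFlow.

Lemma extremely_amenable_ramsey (R : realType) (X : metricType R) :
  omega_homogeneous X -> extremely_amenable (Iso X) ->
  forall (F : {fset X}) (gamma : set (set (embedding F))),
     colouring gamma ->
     forall (G : {fset X}) (e : R), 0 < e ->
       exists2 G' : {fset X}, isometric_copy G G' &
         monochromatic_upto gamma e (factors_through F G').
Proof.
move=> homX eaX F gamma gammaP G e e0; apply: contrapT => nomono.
have covered i : exists2 A, gamma A & A i.
  have [_ [cov _ _]] := gammaP.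
  have : cover gamma id i by rewrite cov.
  by move=> [A gA Ai]; exists A.
pose phi0 (p : embedding F * set (embedding F)) := truncated_dist e p.2 p.1.
have [||phi [h1 h2 h3 h4] phifix] := fixed_point_in_compact eaX _
  (@labellings_compact _ _ F G gamma e gammaP) _
  (@shift_labellings _ _ F G gamma e)
  (@shift1 _ _ F) (@shiftM _ _ F) (@shift_continuous _ _ F G gamma e).
- exact: (@hausdorff_product _ (fun=> R) (fun=> @Rhausdorff R)).
- exists phi0; split=> /= [p|i j A|i|G' GG' A gA].
  + by rewrite truncated_dist_ge0 ?truncated_dist_le // ltW.
  + by rewrite lerBlDl truncated_dist_lip // ltW.
  + have [A gA Ai] := covered i; exists A => //.
    by rewrite /phi0 truncated_dist0 // ltW.
  + apply: contrapT => small; apply: nomono.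
    exists G' => //; exists A => // i iG'.
    apply: contrapT => far; apply: small; exists i => //.
    apply: truncated_dist_lb => // z Az; rewrite leNgt; apply/negP => iz.
    by apply: far; exists z => //; rewrite metric_sym.
have const i A : phi (i, A) = phi (inclusion F, A).
  have [g ->] := embedding_transitive i homX.
  by rewrite -{1}(phifix g) /shift /= -comp_embeddingM mulVg comp_embedding1.
have [A gA A0] := h3 (inclusion F).
have [f] : isometric_copy G G by exists id; split=> // y; exists y.
move=> fP; have [i _] := h4 G (ex_intro _ f fP) A gA.
by rewrite const leNgt (le_lt_trans A0).
Qed.

Unset Implicit Arguments.

Theorem theorem5p9 (R : realType) (X : metricType R)
    (X_homogeneous : omega_homogeneous X) :
  extremely_amenable (Iso X) <->
  (forall (F : {fset X}) (gamma : set (set (embedding F))),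
     colouring gamma ->
     forall (G : {fset X}) (e : R), 0 < e ->
       exists2 G' : {fset X}, isometric_copy G G' &
         monochromatic_upto gamma e (factors_through F G')).
Proof.
split; first exact: extremely_amenable_ramsey.
exact: ramsey_extremely_amenable.
Qed.
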